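(* For each prime power $q\ge 2^{40}$ there exists a $K_4$-free graph $G_q^*$ with $q^2(q^2-q+1)$ vertices such that for every set $X$ of at least $m=2^{24}q^2$ vertices of $G_q^*$, \[ e(G_q^*[X])\;\ge\;\frac{|X|^2}{256q}. \]
   Context: $e(G[X])$ denotes the number of edges of the subgraph of $G$ induced by $X$. *)

(* Defs.v *)
From mathcomp Require Import all_boot all_order all_algebra.
Set Implicit Arguments. Unset Strict Implicit. Unset Printing Implicit Defensive.

Definition prime_power (q : nat) : Prop :=
  exists p k : nat, prime p /\ (0 < k)%N /\ q = (p ^ k)%N.

Definition simple_graph (T : finType) (e : rel T) : Prop :=
  symmetric e /\ irreflexive e.

Definition is_clique (T : finType) (e : rel T) (S : {set T}) : Prop :=
  forall x y, x \in S -> y \in S -> x != y -> e x y.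

Definition K4_free (T : finType) (e : rel T) : Prop :=
  forall S : {set T}, #|S| = 4%N -> ~ is_clique e S.

Definition induced_edges (T : finType) (e : rel T) (X : {set T}) : {set {set T}} :=
  [set E : {set T} | [exists u, exists v,
     [&& u \in X, v \in X, e u v & E == [set u; v]]]].

Definition e_induced (T : finType) (e : rel T) (X : {set T}) : nat :=
  #|induced_edges e X|.

(* Main.v *)
Require Import Defs.
From HB Require Import structures.
From mathcomp Require Import all_boot all_order all_algebra all_field.
From mathcomp Require Import zify ring.
Import GRing.Theory Num.Theory.
Set Implicit Arguments. Unset Strict Implicit. Unset Printing Implicit Defensive.

(** The vertices are the secants of a Hermitian unital in the plane over F_{q^2}. Those through a
    point of the unital form a pencil; colour each pencil by two colours at random and join two
    secants when they meet in a point of the unital at which their colours differ. A K_4 would be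
    four secants, no three of them concurrent on the unital (two colours only), hence an O'Nan
    configuration, which the unital does not contain: for a triangle of isotropic points and a
    transversal meeting its sides in isotropic points, Menelaus' theorem forces the Gram
    determinant of the vertices to vanish.

    For a set X of secants the pencils carry at least q|X| incidences in total. A pencil fails if
    one colour takes at most 1/16 of its part of X; unless the failing pencils carry half of the
    incidences, the Cauchy-Schwarz inequality gives |X|^2/(128 q) edges. Prescribing the set of
    failing pencils and their minority colours (4^(q^3) choices), the exceptional event has
    probability exponentially small in q|X|, which beats the number of sets X of each size. *)

(* Give [w] weight 3 for each disagreement with [s] on [A]: the total weight is 2^|T| 2^|A|,
   while few agreements force a weight of at least 3^(15|A|/16). *)
Lemma card_few_agreements (T : finType) (A : {set T}) (s : T -> bool) :
  #|[set w : {ffun T -> bool} | 16 * #|[set t in A | w t == s t]| <= #|A|]|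
    * 2 ^ (5 * (#|A| %/ 16)) <= 2 ^ #|T|.
Proof.
pose wt t b := if t \in A then (if b == s t then 1 else 3) else 1.
have wtE (w : {ffun T -> bool}) :
    \prod_t wt t (w t) = 3 ^ (#|A| - #|[set t in A | w t == s t]|).
  rewrite -(cardsID [set t | w t == s t] A) addnC.
  have -> : A :&: [set t | w t == s t] = [set t in A | w t == s t].
    by apply/setP=> t; rewrite !inE.
  rewrite addnK (bigID (mem (A :\: [set t | w t == s t]))) /=.
  rewrite (eq_bigr (fun=> 3)); last first.
    by move=> t; rewrite /wt !inE => /andP[/negPf-> ->].
  rewrite prod_nat_const big1 ?muln1 // => t.
  by rewrite /wt !inE negb_and negbK; case: (t \in A); case: eqP.
have sum_wt : \sum_(w : {ffun T -> bool}) \prod_t wt t (w t) = 2 ^ #|T| * 2 ^ #|A|.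
  rewrite -(bigA_distr_bigA wt) (eq_bigr (fun t => 2 * (if t \in A then 2 else 1))).
    by rewrite big_split /= prod_nat_const -big_mkcond prod_nat_const.
  by move=> t _; rewrite big_bool /wt; case: (t \in A) => //; case: (s t).
set B := [set w | _]; set j := #|A| %/ 16.
pose r := #|A| %% 16.
have cA : #|A| = 16 * j + r by rewrite mulnC -divn_eq.
have lb : #|B| * 2 ^ (21 * j + r) <= 2 ^ #|T| * 2 ^ #|A|.
  rewrite -sum_wt (bigID (mem B)) /= -sum_nat_const.
  apply: leq_trans (leq_addr _ _); apply: leq_sum => w; rewrite inE wtE => hw.
  have agree_j : #|[set t in A | w t == s t]| <= j.
    by rewrite /j leq_divRL // mulnC.
  (* There are at least 15j + r disagreements. Keeping 14j + r of them, 9^(7j) >= 8^(7j) = 2^(21j),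
     and 21j = 16j + 5j leaves the saving 2^(5j). *)
  apply: (@leq_trans (3 ^ (2 * (7 * j) + r))); last by rewrite leq_exp2l //; lia.
  have -> : 21 * j + r = 3 * (7 * j) + r by lia.
  rewrite (expnD 2 (3 * _)) (expnD 3 (2 * _)) (expnM 2 3) (expnM 3 2).
  apply: leq_mul; first by case: (posnP (7 * j)) => [->|h] //; rewrite leq_exp2r.
  by case: (posnP r) => [->|h] //; rewrite leq_exp2r.
move: lb; rewrite cA -expnD.
have -> : 21 * j + r = 5 * j + (16 * j + r) by lia.
by rewrite (expnD 2 (5 * j)) (expnD 2 #|T|) mulnA leq_pmul2r ?expn_gt0.
Qed.

(** * Random two-colourings of pencils *)

Definition partial_linear (P L : eqType) (inc : P -> L -> bool) : Prop :=
  forall p p' l l', inc p l -> inc p l' -> inc p' l -> inc p' l' -> l != l' -> p = p'.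

(* An O'Nan configuration consists of four lines meeting pairwise in six distinct points. *)
Definition onan_free (P L : eqType) (inc : P -> L -> bool) : Prop :=
  forall l1 l2 l3 l4 p12 p13 p14 p23 p24 p34,
  all (inc^~ l1) [:: p12; p13; p14] -> all (inc^~ l2) [:: p12; p23; p24] ->
  all (inc^~ l3) [:: p13; p23; p34] -> all (inc^~ l4) [:: p14; p24; p34] ->
  l1 != l2 -> ~~ uniq [:: p12; p13; p14; p23; p24; p34].

Section Coloring.
Variables (P L : finType) (inc : P -> L -> bool).
Hypothesis inc_unique : partial_linear inc.
Hypothesis onan : onan_free inc.

Definition coloring := {ffun P * L -> bool}.

Definition bipartite_pencils (w : coloring) : rel L := fun l l' =>
  [exists p, [&& inc p l, inc p l' & w (p, l) != w (p, l')]].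

Variable w : coloring.
Notation e := (bipartite_pencils w).

Lemma bipartite_pencils_simple : simple_graph e.
Proof.
split=> [l l' | l]; last by apply/existsP=> -[p]; rewrite eqxx !andbF.
by apply/existsP/existsP => -[p /and3P[i i' d]]; exists p; rewrite i i' eq_sym.
Qed.

(** Adjacency only provides some common point with differing colours; by partial linearity it is the
    only common point. *)
Lemma bipartite_pencils_color p l l' :
  e l l' -> l != l' -> inc p l -> inc p l' -> w (p, l) != w (p, l').
Proof.
by move=> /existsP[p' /and3P[i i' d]] ne j j'; rewrite (inc_unique j j' i i' ne).
Qed.

Lemma bipartite_pencils_K4_free : K4_free e.
Proof.
move=> S S4 clS.
have [x0 x0S] : exists x, x \in S by apply/card_gt0P; rewrite S4.
pose l i := nth x0 (enum S) i.
have szS : size (enum S) = 4 by rewrite -cardE.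
have lS i : i < 4 -> l i \in S by move=> i4; rewrite -mem_enum mem_nth ?szS.
have lne i j : i < 4 -> j < 4 -> i != j -> l i != l j.
  by move=> i4 j4; rewrite nth_uniq ?szS ?enum_uniq.
have adj i j : i < 4 -> j < 4 -> i != j -> e (l i) (l j).
  by move=> i4 j4 ij; apply: clS; rewrite ?lS ?lne.
(* Three lines of the clique through a common point would need three colours there. *)
have noconc i j k p : i < 4 -> j < 4 -> k < 4 -> i != j -> j != k -> k != i ->
    inc p (l i) -> inc p (l j) -> inc p (l k) -> False.
  move=> i4 j4 k4 ij jk ki hi hj hk.
  have := bipartite_pencils_color (adj i j i4 j4 ij) (lne i j i4 j4 ij) hi hj.
  have := bipartite_pencils_color (adj j k j4 k4 jk) (lne j k j4 k4 jk) hj hk.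
  have := bipartite_pencils_color (adj k i k4 i4 ki) (lne k i k4 i4 ki) hk hi.
  by case: (w _); case: (w _); case: (w _).
have meet i j : i < 4 -> j < 4 -> i != j -> exists p, inc p (l i) && inc p (l j).
  by move=> i4 j4 ij; have /existsP[p /and3P[h h' _]] := adj i j i4 j4 ij; exists p; rewrite h h'.
have [p01 /andP[a01 b01]] := meet 0 1 isT isT isT.
have [p02 /andP[a02 b02]] := meet 0 2 isT isT isT.
have [p03 /andP[a03 b03]] := meet 0 3 isT isT isT.
have [p12 /andP[a12 b12]] := meet 1 2 isT isT isT.
have [p13 /andP[a13 b13]] := meet 1 3 isT isT isT.
have [p23 /andP[a23 b23]] := meet 2 3 isT isT isT.
have : ~~ uniq [:: p01; p02; p03; p12; p13; p23].
  apply: (@onan (l 0) (l 1) (l 2) (l 3)); rewrite ?lne //=.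
  - by rewrite a01 a02 a03.
  - by rewrite b01 a12 a13.
  - by rewrite b02 b12 a23.
  - by rewrite b03 b13 b23.
(* Two of the six points that coincide would lie on three of the four lines. *)
have ne i j k p p' : i < 4 -> j < 4 -> k < 4 -> i != j -> j != k -> k != i ->
    inc p (l i) -> inc p (l j) -> inc p' (l k) -> p != p'.
  move=> i4 j4 k4 ij jk ki hi hj hk; apply/eqP=> E; rewrite -{}E in hk.
  exact: noconc hi hj hk.
move/negP; apply; rewrite /= !inE !negb_or -!andbA ?andbT.
do ![apply/andP; split].
- exact: (ne 0 1 2).
- exact: (ne 0 1 3).
- exact: (ne 0 1 2).
- exact: (ne 0 1 3).
- exact: (ne 0 1 2).
- exact: (ne 0 2 3).
- exact: (ne 0 2 1).
- exact: (ne 0 2 1).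
- exact: (ne 0 2 3).
- exact: (ne 0 3 1).
- exact: (ne 0 3 1).
- exact: (ne 0 3 2).
- exact: (ne 1 2 3).
- exact: (ne 1 2 3).
- exact: (ne 1 3 2).
Qed.

Definition pencil (X : {set L}) p : {set L} := [set l in X | inc p l].
Definition pencil_color (X : {set L}) p b : {set L} := [set l in pencil X p | w (p, l) == b].

Lemma card_pencil_color X p :
  #|pencil_color X p true| + #|pencil_color X p false| = #|pencil X p|.
Proof.
rewrite -(cardsID [set l | w (p, l)] (pencil X p)); congr (_ + _).
  by apply: eq_card => l; rewrite !inE eqb_id.
by apply: eq_card => l; rewrite !inE eqbF_neg andbC.
Qed.

(** No edge is counted twice: its two lines determine their common point, and the colours at that
    point tell which line comes first. *)
Lemma e_induced_pencils X :
  \sum_p #|pencil_color X p true| * #|pencil_color X p false| <= e_induced e X.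
Proof.
pose S := [set t : P * (L * L) | (t.2.1 \in pencil_color X t.1 true) &&
                                 (t.2.2 \in pencil_color X t.1 false)].
have -> : \sum_p #|pencil_color X p true| * #|pencil_color X p false| = #|S|.
  rewrite -[RHS]sum1_card (partition_big fst predT) //=.
  apply: eq_bigr => p _; rewrite sum1dep_card -cardsX.
  have inj : injective (pair p : L * L -> _) by move=> ? ? [].
  rewrite -(card_imset _ inj); apply: eq_card => -[p' [l l']].
  apply/imsetP/idP => [[[k k']]|].
    by rewrite in_setX => /andP[h h'] [-> -> ->]; rewrite in_set in_set /= eqxx h h'.
  rewrite in_set in_set /= => /andP[/andP[h h'] /eqP <-].
  by exists (l, l') => //; rewrite in_setX h.
have inj : {in S &, injective (fun t : P * (L * L) => [set t.2.1; t.2.2])}.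
  move=> [p [l l']] [p' [k k']]; rewrite !inE /=.
  move=> /andP[/andP[/andP[_ i1] /eqP c1] /andP[/andP[_ i2] /eqP c2]].
  move=> /andP[/andP[/andP[_ j1] /eqP d1] /andP[/andP[_ j2] /eqP d2]] E.
  have ne : l != l' by apply/eqP=> E'; rewrite E' c2 in c1.
  have nk : k != k' by apply/eqP=> E'; rewrite E' d2 in d1.
  have := set21 l l'; rewrite E => /set2P[] e1.
    have := set22 l l'; rewrite E => /set2P[] e2; first by rewrite e1 e2 eqxx in ne.
    by rewrite -e1 -e2 in j1 j2 *; rewrite (inc_unique i1 i2 j1 j2 ne).
  have := set22 l l'; rewrite E => /set2P[] e2; last by rewrite e1 e2 eqxx in ne.
  rewrite -e1 -e2 in j1 j2 d1 d2.
  by move: c1; rewrite (inc_unique i1 i2 j2 j1 ne) d2.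
rewrite -(card_in_imset inj); apply/subset_leq_card/subsetP => E /imsetP[[p [l l']]].
rewrite !inE /= => /andP[/andP[/andP[xl i1] /eqP c1] /andP[/andP[xl' i2] /eqP c2]] ->.
apply/existsP; exists l; apply/existsP; exists l'; rewrite xl xl' eqxx andbT /=.
by apply/existsP; exists p; rewrite i1 i2 c1 c2.
Qed.

Lemma sum_card_pencil X : \sum_p #|pencil X p| = \sum_(l in X) #|[set p | inc p l]|.
Proof.
under eq_bigr => p _ do rewrite -sum1dep_card.
under [RHS]eq_bigr => l _ do rewrite -sum1dep_card.
by rewrite [RHS](exchange_big_dep predT) //=.
Qed.

End Coloring.

(** * Numerical inequalities and the union bound *)

Lemma sqr_sum_leq (I : finType) (A : {set I}) (f : I -> nat) :
  (\sum_(i in A) f i) ^ 2 <= #|A| * \sum_(i in A) f i ^ 2.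
Proof.
rewrite -mulnn big_distrlr /= -(leq_pmul2l (isT : 0 < 2)) big_distrr /=.
under eq_bigr => i _ do rewrite big_distrr /=.
apply: (@leq_trans (\sum_(i in A) \sum_(j in A) (f i ^ 2 + f j ^ 2))).
  by apply: leq_sum => i _; apply: leq_sum => j _; apply: nat_Cauchy.
under eq_bigr => i _ do rewrite big_split /= sum_nat_const.
by rewrite big_split /= -big_distrr sum_nat_const /= mul2n addnn.
Qed.

Lemma bin_leq_exp n m : 'C(n, m) <= n ^ m.
Proof.
apply: (@leq_trans (n ^_ m)); first by rewrite -bin_ffact leq_pmulr ?fact_gt0.
elim: m => // m IH; rewrite ffactnSr expnSr leq_mul //; exact: leq_subr.
Qed.

Lemma succ_mul_leq_exp2 k : 2 ^ 5 <= k -> k.+1 * 2 ^ 9 <= 2 ^ k.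
Proof.
move=> k_large; apply: (@leq_trans (2 ^ (k./2).+1 * 2 ^ 9)).
  rewrite leq_mul2r; apply/orP; right.
  rewrite expnS; apply: (@leq_trans (2 * (k./2).+1)); first by lia.
  by rewrite leq_mul2l ltn_expl.
rewrite -expnD leq_exp2l //; lia.
Qed.

(** With M = |L| + 2 there are at most M^x sets of size x, so each size excludes at most |W|/M
    elements. There are only M - 1 sizes, which makes the final inequality strict. *)
Lemma union_bound_over_sets (W L : finType) (big : pred {set L}) (bad : {set L} -> {set W}) :
  0 < #|W| ->
  (forall X, big X -> #|bad X| * #|L|.+2 ^ #|X|.+1 <= #|W|) ->
  exists w, forall X, big X -> w \notin bad X.
Proof.
move=> W_gt0 bound; set M := #|L|.+2 in bound.
suff lt_bad : \sum_(X | big X) #|bad X| < #|W|.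
  suff /existsP[w /forallP h] : [exists w, [forall X, big X ==> (w \notin bad X)]].
    by exists w => X bX; apply: (implyP (h X)).
  move: lt_bad; apply: contraTT => /existsPn h; rewrite -leqNgt -sum1_card.
  apply: (@leq_trans (\sum_w \sum_(X | big X) (w \in bad X))).
    apply: leq_sum => w _; have /forallPn[X] := h w.
    by rewrite negb_imply negbK => /andP[bX wX]; rewrite (bigD1 X) //= wX.
  rewrite exchange_big /=; apply: leq_sum => X _.
  by rewrite -sum1_card [X in _ <= X]big_mkcond.
have M_gt0 : 0 < M by [].
rewrite -(ltn_pmul2l M_gt0) (partition_big (fun X : {set L} => inord #|X|) (mem 'I_#|L|.+1)) //=.
rewrite big_distrr /=; apply: (@leq_ltn_trans (\sum_(x < #|L|.+1) #|W|)); last first.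
  by rewrite sum_nat_const card_ord ltn_pmul2r.
apply: leq_sum => x _; rewrite -(leq_pmul2r (_ : 0 < M ^ x)) ?expn_gt0 ?M_gt0 //.
apply: (@leq_trans (\sum_(X : {set L} | #|X| == x) #|W|)); last first.
  rewrite sum_nat_cond_const card_draws mulnC leq_mul2l; apply/orP; right.
  apply: leq_trans (bin_leq_exp _ _) _.
  by case: (posnP x) => [->|x_gt0] //; rewrite leq_exp2r // leqW.
rewrite mulnC mulnA -expnSr big_distrr /= big_mkcond [X in _ <= X]big_mkcond /=.
apply: leq_sum => X _; case: ifP => // /andP[bX /eqP eX].
have cX : #|X| = x by rewrite -eX inordK // ltnS max_card.
by rewrite cX eqxx mulnC -[X in M ^ X.+1]cX bound.
Qed.

(** * Edge counts and the exceptional event *)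

Section RandomColoring.
Variables (P L : finType) (inc : P -> L -> bool) (q : nat).
Hypotheses (cardP : #|P| <= q ^ 3) (card_line : forall l, q <= #|[set p | inc p l]|).

Notation pencil := (pencil inc).
Notation pencil_color := (pencil_color inc).

(* The constant 16 leaves room: a balanced pencil with x lines in X spans at least x^2/32 edges. *)
Definition unbalanced (X : {set L}) (w : coloring P L) : {set P} :=
  [set p | (16 * #|pencil_color w X p true| <= #|pencil X p|)
        || (16 * #|pencil_color w X p false| <= #|pencil X p|)].

(* The exceptional event for X. Off it, the pencils that are balanced carry half of the incidences. *)
Definition mostly_unbalanced (X : {set L}) : {set coloring P L} :=
  [set w | \sum_p #|pencil X p| <= 2 * \sum_(p in unbalanced X w) #|pencil X p|].

Lemma leq_sum_card_pencil (X : {set L}) : q * #|X| <= \sum_p #|pencil X p|.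
Proof.
by rewrite sum_card_pencil mulnC -sum_nat_const; apply: leq_sum => l _; apply: card_line.
Qed.

Lemma e_induced_balanced (X : {set L}) w :
  partial_linear inc ->
  0 < q -> w \notin mostly_unbalanced X ->
  #|X| ^ 2 <= 128 * q * e_induced (bipartite_pencils inc w) X.
Proof.
move=> inc_unique q_gt0; rewrite inE -ltnNge => hw.
set G := ~: unbalanced X w; pose x p := #|pencil X p|.
have hG : \sum_p x p <= 2 * \sum_(p in G) x p.
  have eG : \sum_(p in G) x p = \sum_(p | p \notin unbalanced X w) x p.
    by apply: eq_bigl => p; rewrite inE.
  rewrite [X in _ < X](bigID (mem (unbalanced X w))) /= in hw.
  by rewrite eG (bigID (mem (unbalanced X w))) /= /x; lia.
(* The smaller colour class exceeds x/16 and the larger one is at least x/2. *)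
have ab p : p \in G ->
    x p ^ 2 <= 32 * (#|pencil_color w X p true| * #|pencil_color w X p false|).
  rewrite !inE negb_or -!ltnNge /x -(card_pencil_color inc w X p).
  move: #|_| #|_| => a b /andP[ha hb].
  have [leab|ltba] := leqP a b; nia.
have hS : \sum_(p in G) x p ^ 2 <= 32 * e_induced (bipartite_pencils inc w) X.
  apply: (@leq_trans (32 * \sum_p #|pencil_color w X p true| * #|pencil_color w X p false|)).
    rewrite big_distrr [X in _ <= X](bigID (mem G)) /=.
    by apply: leq_trans (leq_addr _ _); apply: leq_sum.
  by rewrite leq_mul2l e_induced_pencils.
have := leq_sum_card_pencil X; have := sqr_sum_leq G x.
have cG : #|G| <= q ^ 3 := leq_trans (max_card _) cardP.
move: hG hS cG; rewrite -/x.
move: (e_induced _ _) (\sum_(p in G) _) (\sum_(p in G) _) (\sum_p _) #|X| #|G|.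
move=> e S2 S1 N n g hN hS hg hCS hn.
(* The chain is (q|X|)^2 <= (2 S1)^2 <= 4 |G| S2 <= 4 q^3 (32 e), divided by q^2. *)
rewrite -(leq_pmul2l (m := q ^ 2)) ?expn_gt0 ?q_gt0 // -expnMn.
apply: (@leq_trans ((2 * S1) ^ 2)); first by rewrite leq_exp2r // (leq_trans hn).
rewrite expnMn; apply: (@leq_trans (4 * (q ^ 3 * (32 * e)))).
  by rewrite leq_mul2l /= (leq_trans hCS) // leq_mul.
by rewrite (_ : 4 * _ = q ^ 2 * (128 * q * e)) //; ring.
Qed.

(** Classify the colourings by their set F of failing pencils and a choice s of scarce colours,
    2^(2|P|) classes at most. In a nonempty class the incidences in F number at least half of the
    total, and each colouring agrees with s on at most 1/16 of them, so [card_few_agreements] bounds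
    the class. *)
Lemma card_mostly_unbalanced (X : {set L}) :
  #|mostly_unbalanced X| * 2 ^ (5 * ((\sum_p #|pencil X p|) %/ 32)) <=
    2 ^ (#|P| + #|P|) * 2 ^ #|{: P * L}|.
Proof.
set N := \sum_p _.
pose A (F : {set P}) := [set t : P * L | (t.1 \in F) && (t.2 \in pencil X t.1)].
have cardA (F : {set P}) (Q : P -> pred L) : 
    #|[set t in A F | Q t.1 t.2]| = \sum_(p in F) #|[set l in pencil X p | Q p l]|.
  rewrite -sum1_card (partition_big fst (mem F)) /=; last first.
    by move=> t; rewrite !inE => /andP[/andP[]].
  apply: eq_bigr => p pF; rewrite sum1dep_card.
  have inj : injective (pair p : L -> _) by move=> ? ? [].
  rewrite -(card_imset _ inj); apply: eq_card => -[p' l].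
  rewrite in_set in_set in_set /=; apply/andP/imsetP => [[/andP[/andP[_ h] hQ] /eqP <-]|].
    by exists l; rewrite // in_set h.
  by move=> [l']; rewrite in_set => /andP[h hQ] [-> ->]; rewrite pF h hQ eqxx.
(* At a failing pencil where [true] is not scarce, [false] must be, so the value of [sg] is always a
   scarce colour there. *)
pose sg (w : coloring P L) := [ffun p => 16 * #|pencil_color w X p true| <= #|pencil X p|].
rewrite -sum1_card (partition_big (fun w => (unbalanced X w, sg w)) predT) //=.
rewrite big_distrl /=.
apply: (@leq_trans (\sum_(Fs : {set P} * {ffun P -> bool}) 2 ^ #|{: P * L}|)); last first.
  have card_sets : #|{: {set P}}| = 2 ^ #|P|.
    by have := card_powerset [set: P]; rewrite powersetT !cardsT.
  have card_Fs : #|{: {set P} * {ffun P -> bool}}| = 2 ^ (#|P| + #|P|).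
    by rewrite card_prod -[#|{set P}|]/(#|{: {set P}}|) card_sets card_ffun card_bool -expnD.
  by rewrite sum_nat_const -card_Fs.
apply: leq_sum => -[F s] _; rewrite sum1dep_card.
set B := [set w | _].
have [->|[w0]] := set_0Vmem B; first by rewrite cards0.
rewrite inE xpair_eqE => /and3P[]; rewrite inE -/N => hN /eqP eF _.
have cA : #|A F| = \sum_(p in F) #|pencil X p|.
  have := cardA F (fun _ => predT); rewrite (_ : [set t in A F | _] = A F); last first.
    by apply/setP=> t; rewrite !inE andbT.
  by move=> ->; apply: eq_bigr => p _; apply: eq_card => l; rewrite !inE andbT.
rewrite eF -cA in hN.
apply: leq_trans (card_few_agreements (A F) (fun t => s t.1)).
apply: leq_mul; last first.
  rewrite leq_exp2l // leq_mul2l /= (_ : 32 = 2 * 16) // divnMA leq_div2r //.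
  by rewrite -(mulKn #|A F| (isT : 0 < 2)) leq_div2r.
apply/subset_leq_card/subsetP => w; rewrite [w \in B]inE xpair_eqE.
move=> /and3P[_ /eqP ewF /eqP ews]; rewrite in_set.
have -> : #|[set t in A F | w t == s t.1]| =
    \sum_(p in F) #|pencil_color w X p (s p)|.
  rewrite -(cardA F (fun p l => w (p, l) == s p)).
  by apply: eq_card => -[p l]; rewrite !inE.
rewrite cA big_distrr /= -ewF; apply: leq_sum => p; rewrite -ews ffunE inE.
by case: leqP.
Qed.

Lemma exists_balanced_coloring :
  2 ^ 14 <= q -> #|L|.+2 <= q ^ 4 ->
  exists w, forall X : {set L}, 2 ^ 7 * q ^ 2 <= #|X| -> w \notin mostly_unbalanced X.
Proof.
move=> q_large cardL.
apply: (union_bound_over_sets (big := fun X : {set L} => 2 ^ 7 * q ^ 2 <= #|X|)).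
  by apply/card_gt0P; exists [ffun=> true].
move=> X X_large; rewrite card_ffun card_bool.
have hN := leq_sum_card_pencil X; set N := \sum_p _ in hN.
(* This k turns powers of q into powers of 2 through q <= 2^k, while 2^9 k <= q keeps 4k(x + 1) <=
   8kx below N/64. *)
set x := #|X| in X_large hN *; pose k := q %/ 2 ^ 9.
have q_leq : q <= 2 ^ k.
  have k_large : 2 ^ 5 <= k by rewrite leq_divRL ?expn_gt0 // -expnD.
  apply: ltnW; apply: (@leq_trans (k.+1 * 2 ^ 9)); first by rewrite ltn_ceil ?expn_gt0.
  exact: succ_mul_leq_exp2.
(* The choices of F and s cost 2|P| <= 2 q^3 and the union bound costs 4k(x + 1). Each is at most
   N/64; for the first this is where |X| >= 2^7 q^2 enters. *)
have exponent : (#|P| + #|P|) + k * 4 * x.+1 <= 5 * (N %/ 32).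
  apply: (@leq_trans (N %/ 32)); last by rewrite leq_pmull.
  have points : (#|P| + #|P|) * 64 <= N.
    apply: leq_trans hN; apply: (@leq_trans (q * (2 ^ 7 * q ^ 2))); last first.
      by rewrite leq_mul2l X_large orbT.
    by rewrite mulnCA -expnS; lia.
  have sets : k * 4 * x.+1 * 64 <= N.
    apply: leq_trans hN; apply: (@leq_trans (k * 2 ^ 9 * x)); last first.
      by rewrite leq_mul2r leq_divM orbT.
    have x_gt0 : 0 < x.
      by rewrite (leq_trans _ X_large) // muln_gt0 !expn_gt0 (leq_trans _ q_large) ?expn_gt0.
    by rewrite -!mulnA leq_mul2l; apply/orP; right; lia.
  rewrite leq_divRL // mulnDl; move: points sets; move: (k * 4 * x.+1) => K; lia.
have M_leq : #|L|.+2 ^ x.+1 <= 2 ^ (k * 4 * x.+1).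
  by rewrite expnM leq_exp2r // (leq_trans cardL) // expnM leq_exp2r.
have pow_gt0 : 0 < 2 ^ (5 * (N %/ 32)) by rewrite expn_gt0.
rewrite -(leq_pmul2r pow_gt0) mulnAC.
apply: leq_trans (leq_mul (card_mostly_unbalanced X) M_leq) _.
by rewrite mulnAC -expnD mulnC leq_pmul2l ?expn_gt0 // leq_exp2l.
Qed.

End RandomColoring.

(** * The Hermitian unital *)

Local Open Scope ring_scope.

(** Sloped and vertical lines are kept apart, so that each affine line has a single code and lines
    can be compared by equality. *)
Definition on_line (F : fieldType) (u : F * F) (l : F * F + F) : bool :=
  match l with
  | inl (m, b) => u.2 == m * u.1 + b
  | inr c => u.1 == c
  end.

Lemma on_line_unique (F : fieldType) (u v : F * F) (l k : F * F + F) :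
  on_line u l -> on_line v l -> on_line u k -> on_line v k -> u != v -> l = k.
Proof.
case: u v => [x y] [x' y']; case: l k => [[m b]|c] [[m' b']|c'] //=.
- move=> /eqP-> /eqP-> /eqP e /eqP e' ne.
  have hx : x - x' != 0.
    by apply: contra ne; rewrite subr_eq0 => /eqP->.
  have em : m = m'.
    apply: (mulIf hx); have -> : m * (x - x') = (m * x + b) - (m * x' + b) by ring.
    by rewrite e e'; ring.
  by move: e; rewrite em => /addrI->.
- by move=> /eqP-> /eqP-> /eqP-> /eqP->; rewrite eqxx.
- by move=> /eqP-> /eqP-> /eqP-> /eqP->; rewrite eqxx.
- by move=> /eqP-> _ /eqP->.
Qed.

Definition area (F : fieldType) (u v w : F * F) : F :=
  (v.1 - u.1) * (w.2 - u.2) - (w.1 - u.1) * (v.2 - u.2).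

Lemma on_line_area (F : fieldType) (u v w : F * F) (l : F * F + F) :
  on_line u l -> on_line v l -> u != v -> (on_line w l) = (area u v w == 0).
Proof.
rewrite /area; case: u v w => [x y] [x' y'] [x'' y'']; case: l => [[m b]|c] /=.
- move=> /eqP-> /eqP-> ne.
  have hx : x' - x != 0.
    by apply: contra ne; rewrite subr_eq0 => /eqP->.
  have -> : (x' - x) * (y'' - (m * x + b)) - (x'' - x) * (m * x' + b - (m * x + b))
     = (x' - x) * (y'' - (m * x'' + b)) by ring.
  by rewrite mulf_eq0 (negPf hx) /= subr_eq0.
- move=> /eqP-> /eqP-> ne; rewrite subrr mul0r sub0r oppr_eq0 mulf_eq0 !subr_eq0.
  case: (x'' == c) => //=; apply/esym/negbTE; apply: contra ne => /eqP->; exact: eqxx.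
Qed.

Lemma on_line_param (F : fieldType) (u v w : F * F) (l : F * F + F) :
  on_line u l -> on_line v l -> on_line w l -> u != v ->
  exists t, w = ((1 - t) * u.1 + t * v.1, (1 - t) * u.2 + t * v.2).
Proof.
case: u v w => [x y] [x' y'] [x'' y'']; case: l => [[m b]|c] /=.
- move=> /eqP-> /eqP-> /eqP-> ne.
  have hx : x' - x != 0.
    by apply: contra ne; rewrite subr_eq0 => /eqP->.
  by exists ((x'' - x) / (x' - x)); congr pair; field.
- move=> /eqP-> /eqP-> /eqP-> ne.
  have hy : y' - y != 0.
    by apply: contra ne; rewrite subr_eq0 => /eqP->.
  by exists ((y'' - y) / (y' - y)); congr pair; field.
Qed.

(* Affine part of the Hermitian unital, for s x = x^q; the point at infinity is left out. *)
Definition on_unital (F : fieldType) (s : F -> F) (u : F * F) : bool :=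
  u.1 * s u.1 == s u.2 + u.2.


(** Expand the Hermitian form at the third point: the diagonal terms vanish because the first two
    points are isotropic, and the cross terms remain. *)
Lemma unital_param (F : fieldType) (s : {rmorphism F -> F}) (x y x' y' t : F) :
  on_unital s (x, y) -> on_unital s (x', y') ->
  on_unital s ((1 - t) * x + t * x', (1 - t) * y + t * y') ->
  (1 - t) * s t * (x * s x' - y - s y') + t * (1 - s t) * (x' * s x - y' - s y) = 0.
Proof.
rewrite /on_unital /= !(rmorphD, rmorphN, rmorphM, rmorph1).
move=> /eqP h /eqP h' /eqP ht.
transitivity ((((1 - t) * x + t * x') * ((1 - s t) * s x + s t * s x')
    - ((1 - s t) * s y + s t * s y' + ((1 - t) * y + t * y')))
  - (1 - t) * (1 - s t) * (x * s x - (s y + y))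
  - t * s t * (x' * s x' - (s y' + y'))); first by ring.
by rewrite ht h h' !subrr !mulr0 !subr0.
Qed.

(** The triangle has sides [l1], [l2], [l3], and [l4] is the transversal. The product of the three
    relations from [unital_param] loses its parameters through Menelaus' relation and its image
    under [s], which leaves the Gram determinant equal to 0. *)
Lemma unital_onan_free (F : fieldType) (s : {rmorphism F -> F})
  (l1 l2 l3 l4 : F * F + F) (p12 p13 p14 p23 p24 p34 : F * F) :
  all (on_unital s) [:: p12; p13; p14; p23; p24; p34] ->
  all [pred u | on_line u l1] [:: p12; p13; p14] ->
  all [pred u | on_line u l2] [:: p12; p23; p24] ->
  all [pred u | on_line u l3] [:: p13; p23; p34] ->
  all [pred u | on_line u l4] [:: p14; p24; p34] ->
  l1 != l2 -> ~~ uniq [:: p12; p13; p14; p23; p24; p34].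
Proof.
move=> /=; rewrite !andbT => /and5P[h12 h13 h14 h23 /andP[h24 h34]].
move=> /and3P[i12 i13 i14] /and3P[j12 j23 j24] /and3P[k13 k23 k34].
move=> /and3P[m14 m24 m34] ne12; apply/negP; rewrite !inE !negb_or -!andbA ?andbT.
move=> /and5P[d12_13 _ d12_23 d12_24 /and5P[_ d13_14 d13_23 _ /and5P[_ _ _ _ /and3P[_ d23_34 d24_34]]]].
have D0 : area p12 p23 p13 != 0.
  rewrite -(on_line_area _ j12 j23 d12_23); apply: contra ne12 => j13.
  by apply/eqP; apply: (on_line_unique i12 i13 j12 j13 d12_13).
have d13_12 : p13 != p12 by rewrite eq_sym.
have d23_13 : p23 != p13 by rewrite eq_sym.
(* The sides are oriented cyclically, p13 to p12 to p23 to p13, so that Menelaus' relation is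
   symmetric in a, b, c. *)
have [a ea] := on_line_param i13 i12 i14 d13_12.
have [b eb] := on_line_param j12 j23 j24 d12_23.
have [c ec] := on_line_param k23 k13 k34 d23_13.
move: m14; rewrite (on_line_area _ m24 m34 d24_34) => D4.
have param_neq0 (t : F) (u v w : F * F) :
    w = ((1 - t) * u.1 + t * v.1, (1 - t) * u.2 + t * v.2) -> u != w -> t != 0.
  move=> ->; apply: contra => /eqP->.
  by rewrite subr0 !mul1r !mul0r !addr0 -surjective_pairing.
have abc0 : a * b * c != 0.
  by rewrite !mulf_neq0 // ?(param_neq0 _ _ _ _ ea) ?(param_neq0 _ _ _ _ eb) ?(param_neq0 _ _ _ _ ec).
move: D0 D4 h12 h13 h23 h14 h24 h34; rewrite ea eb ec /area.
clear i12 i13 i14 j12 j23 j24 k13 k23 k34 m24 m34 d12_13 d12_23 d12_24.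
clear d13_14 d13_23 d23_34 d24_34 d13_12 d23_13 ea eb ec.
case: p12 p23 p13 => [x1 y1] [x2 y2] [x3 y3] /= D0 D4 h1 h3 h2 hQ2 hQ3 hQ1.
have {hQ1} e1 := unital_param h2 h3 hQ1.
have {hQ2} e2 := unital_param h3 h1 hQ2.
have {hQ3} e3 := unital_param h1 h2 hQ3.
(* Menelaus: the points of parameters a, b, c on the sides of the triangle are collinear. *)
have abcE : (1 - a) * (1 - b) * (1 - c) = - (a * b * c).
  apply/eqP; rewrite -addr_eq0 -(mulIr_eq0 _ (mulIf D0)) -[X in _ == X](eqP D4).
  by apply/eqP; ring.
have sabcE : (1 - s a) * (1 - s b) * (1 - s c) = - (s a * s b * s c).
  transitivity (s ((1 - a) * (1 - b) * (1 - c))).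
    by rewrite !rmorphM !(rmorphD, rmorphN, rmorph1).
  by rewrite abcE rmorphN !rmorphM.
have sabc0 : s a * s b * s c != 0 by rewrite -!rmorphM fmorph_eq0.
set H12 := x1 * s x2 - y1 - s y2 in e3.
set H21 := x2 * s x1 - y2 - s y1 in e3.
set H23 := x2 * s x3 - y2 - s y3 in e1.
set H32 := x3 * s x2 - y3 - s y2 in e1.
set H31 := x3 * s x1 - y3 - s y1 in e2.
set H13 := x1 * s x3 - y1 - s y3 in e2.
(* H12, ..., are the values of the Hermitian form on the vertices; the Gram determinant below
   is the norm of the area of the triangle, up to sign, so it cannot vanish. *)
have gram : H12 * H23 * H31 + H21 * H32 * H13 = 0.
  apply/eqP; rewrite -(mulIr_eq0 _ (mulIf (mulf_neq0 abc0 sabc0))).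
  move: e1 e2 e3 => /eqP + /eqP + /eqP; rewrite !addr_eq0 => /eqP e1 /eqP e2 /eqP e3.
  have : ((1 - a) * s a * H31) * ((1 - b) * s b * H12) * ((1 - c) * s c * H23)
     = - ((a * b * c) * ((1 - s a) * (1 - s b) * (1 - s c)) * (H21 * H32 * H13)).
    by rewrite e1 e2 e3; ring.
  rewrite sabcE.
  have -> : (1 - a) * s a * H31 * ((1 - b) * s b * H12) * ((1 - c) * s c * H23)
    = (1 - a) * (1 - b) * (1 - c) * (s a * s b * s c) * (H12 * H23 * H31) by ring.
  rewrite abcE => e; apply/eqP; rewrite mulrDl.
  have -> : H12 * H23 * H31 * (a * b * c * (s a * s b * s c)) =
    - (- (a * b * c) * (s a * s b * s c) * (H12 * H23 * H31)) by ring.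
  by rewrite e; ring.
(* The unital equation eliminates [s y] at each vertex, which reduces the norm identity to a
   polynomial one. *)
have sy x y : on_unital s (x, y) -> s y = x * s x - y.
  by move=> /eqP /= ->; rewrite addrK.
have sD0 := D0; rewrite -(fmorph_eq0 s) in sD0.
move/eqP: (mulf_neq0 D0 sD0); apply; rewrite -[RHS]oppr0 -gram /H12 /H21 /H23 /H32 /H31 /H13.
rewrite !(rmorphD, rmorphN, rmorphM) (sy _ _ h1) (sy _ _ h2) (sy _ _ h3); ring.
Qed.

(** * Counting points and secants over a finite field *)

Lemma card_poly_roots (F : finFieldType) (p : {poly F}) n :
  size p = n.+1 -> (#|[set x | root p x]| <= n)%N.
Proof.
move=> sp; have p0 : p != 0 by rewrite -size_poly_gt0 sp.
rewrite -ltnS -sp cardE; apply: max_poly_roots => //; last exact: enum_uniq.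
by apply/allP=> x; rewrite mem_enum inE.
Qed.

(** If one fibre had fewer than c elements, the others could not make up the total c|E|. This turns
    root-count upper bounds for trace and norm fibres into lower bounds. *)
Lemma leq_card_fiber (aT rT : finType) (f : aT -> rT) (D : {set aT}) (E : {set rT}) c :
  {in D, forall x, f x \in E} ->
  {in E, forall y, #|[set x in D | f x == y]| <= c}%N ->
  (c * #|E| <= #|D|)%N ->
  {in E, forall y, c <= #|[set x in D | f x == y]|}%N.
Proof.
move=> fDE fib cD y yE; rewrite leqNgt; apply/negP => lt_c.
move: cD; apply/negP; rewrite -ltnNge.
rewrite -sum1_card (partition_big f (mem E)) //= mulnC -sum_nat_const.
rewrite (bigD1 y) // [X in (_ < X)%N](bigD1 y) //=.
rewrite -addSn; apply: leq_add.
  by rewrite sum1dep_card.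
by apply: leq_sum => z /andP[zE _]; rewrite sum1dep_card fib.
Qed.

(** The proof [pR] is an argument so that the ring morphism structure can be attached to the
    function. *)
Definition frob_iter (R : comNzRingType) (p k : nat) (pR : p \in [pchar R]) (x : R) : R :=
  x ^+ (p ^ k).

Section FrobIter.
Variables (R : comNzRingType) (p k : nat) (pR : p \in [pchar R]).

Lemma frob_iter_pchar : [pchar R].-nat (p ^ k)%N.
Proof. by rewrite (eq_pnat _ (pcharf_eq pR)) pnatX pnat_id ?(pcharf_prime pR). Qed.

Lemma frob_iterB : {morph @frob_iter R p k pR : x y / x - y}.
Proof.
move=> x y; rewrite /frob_iter exprDn_pchar ?frob_iter_pchar //.
by rewrite exprNn_pchar ?frob_iter_pchar.
Qed.

Lemma frob_iterM : monoid_morphism (@frob_iter R p k pR).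
Proof. by split=> [|x y]; rewrite /frob_iter ?expr1n ?exprMn. Qed.

HB.instance Definition _ := GRing.isZmodMorphism.Build R R (@frob_iter R p k pR) frob_iterB.
HB.instance Definition _ := GRing.isMonoidMorphism.Build R R (@frob_iter R p k pR) frob_iterM.

End FrobIter.

Section Unital.
Variables (F : finFieldType) (p k : nat) (pF : p \in [pchar F]).
Let q := (p ^ k)%N.
Hypotheses (k_gt0 : (0 < k)%N) (cardF : #|F| = (q ^ 2)%N).
Notation s := (@frob_iter F p k pF).

Let q_gt1 : (1 < q)%N.
Proof. by rewrite -(exp1n k) ltn_exp2r // prime_gt1 // (pcharf_prime pF). Qed.

Let s_invol : involutive s.
Proof. by move=> x; rewrite /frob_iter -exprM mulnn -cardF expf_card. Qed.

Let fixed : {set F} := [set x | s x == x].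

Lemma card_frob_fixed : (#|fixed| <= q)%N.
Proof.
have sp : size ('X^q - 'X : {poly F}) = q.+1.
  by rewrite size_polyDl ?size_polyXn // size_polyN size_polyX.
apply: leq_trans (card_poly_roots sp); apply/subset_leq_card/subsetP => x.
by rewrite !inE /root !hornerE subr_eq0.
Qed.

Lemma card_trace_fiber_le (t : F) : (#|[set y | (s y + y == t)%R]| <= q)%N.
Proof.
have sp : size ('X^q + ('X - t%:P) : {poly F}) = q.+1.
  by rewrite size_polyDl size_polyXn // size_XsubC.
apply: leq_trans (card_poly_roots sp); apply/subset_leq_card/subsetP => x.
by rewrite !inE /root !hornerE -subr_eq0 ?addrA.
Qed.

(** The trace sends q^2 elements into at most q fixed ones with fibres of size at most q, so all
    fibres are full. *)
Lemma card_trace_fiber_ge (t : F) : t \in fixed -> (q <= #|[set y | (s y + y == t)%R]|)%N.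
Proof.
move=> tfix; have := @leq_card_fiber F F (fun y => s y + y) [set: F] fixed q.
move=> /(_ _ _ _ t tfix); rewrite (_ : [set x in _ | _] = [set y | s y + y == t]).
  apply.
  - by move=> y _; rewrite inE rmorphD /= s_invol addrC.
  - move=> z _; apply: leq_trans (card_trace_fiber_le z).
    by apply/subset_leq_card/subsetP => x; rewrite !inE.
  - by rewrite cardsT cardF -mulnn leq_mul2l card_frob_fixed orbT.
by apply/setP=> x; rewrite !inE.
Qed.

(** The same count for the norm on nonzero elements: q^2 - 1 = (q + 1)(q - 1). *)
Lemma card_norm_fiber_ge (t : F) :
  t \in fixed -> t != 0 -> (q.+1 <= #|[set x | (x * s x == t)%R]|)%N.
Proof.
move=> tfix t0; have := @leq_card_fiber F F (fun x => x * s x) [set~ 0] (fixed :\ 0) q.+1.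
move=> H; apply: leq_trans (H _ _ _ t _) _.
- move=> x; rewrite !inE => x0; rewrite mulf_eq0 fmorph_eq0 negb_or x0 /=.
  by rewrite rmorphM /= s_invol mulrC.
- move=> z _.
  have sp : size ('X^(q.+1) - z%:P : {poly F}) = q.+2.
    by rewrite size_XnsubC.
  apply: leq_trans (card_poly_roots sp); apply/subset_leq_card/subsetP => x.
  by rewrite !inE /root !hornerE subr_eq0 exprS => /andP[_].
- have fix0 : 0 \in fixed by rewrite inE rmorph0.
  have := card_frob_fixed; rewrite (cardsD1 0) fix0 add1n cardsC1 cardF => h.
  have -> : (q ^ 2).-1 = (q.+1 * (q - 1))%N by rewrite -subn1 -[1%N](exp1n 2) subn_sqr mulnC addn1.
  by rewrite leq_mul2l -ltnS subn1 prednK ?h ?orbT //; apply: ltnW.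
- by rewrite !inE t0; rewrite inE in tfix.
- by apply/subset_leq_card/subsetP => x; rewrite !inE => /andP[_].
Qed.

Lemma card_unital_points : (#|[set u : F * F | on_unital s u]| <= q ^ 3)%N.
Proof.
rewrite -sum1_card (partition_big fst predT) //=.
apply: (@leq_trans (\sum_(x : F) q)); last by rewrite sum_nat_const cardF -expnSr.
apply: leq_sum => x _; rewrite sum1dep_card.
apply: leq_trans (card_trace_fiber_le (x * s x)).
rewrite -(card_imset _ (can_inj (fun y : F => erefl : snd (x, y) = y))).
apply/subset_leq_card/subsetP => -[x' y] /=; rewrite !inE => /andP[h /eqP /= ex].
by apply/imsetP; exists y; rewrite ?inE -ex // eq_sym.
Qed.

(* A line y = m x + b for which the excluded value is 0 is tangent to the unital. *)
Definition secant (l : F * F + F) : bool :=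
  if l is inl (m, b) then s b + b + m * s m != 0 else true.

Lemma secant_card (l : F * F + F) :
  secant l -> (q <= #|[set u | on_unital s u && on_line u l]|)%N.
Proof.
case: l => [[m b]|c] /= hl.
- (* With x = z + s m, the point (x, m x + b) is on the curve iff z * s z = s b + b + m * s m. *)
  have tfix : s b + b + m * s m \in fixed.
    by rewrite inE !rmorphD rmorphM /= !s_invol (addrC b) (mulrC (s m)).
  (* Sloped secants have q + 1 points; the common bound is q because vertical lines lose their point
     at infinity. *)
  apply: leq_trans (leqnSn q) _; apply: leq_trans (card_norm_fiber_ge tfix hl) _.
  have inj : injective (fun z => (z + s m, m * (z + s m) + b)).
    by move=> z z' [/addIr].
  rewrite -(card_imset _ inj); apply/subset_leq_card/subsetP => u /imsetP[z].
  rewrite inE => /eqP hz ->; rewrite inE /= eqxx andbT /on_unital /=.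
  rewrite !(rmorphD, rmorphM) /= s_invol; apply/eqP.
  transitivity (z * s z + m * z + s m * s z + m * s m); first by ring.
  by rewrite hz; ring.
- have tfix : c * s c \in fixed by rewrite inE rmorphM /= s_invol mulrC.
  apply: leq_trans (card_trace_fiber_ge tfix) _.
  rewrite -(card_imset _ (can_inj (fun y : F => erefl : snd (c, y) = y))).
  apply/subset_leq_card/subsetP => u /imsetP[y]; rewrite inE => /eqP hy ->.
  by rewrite inE /= eqxx andbT /on_unital /= hy.
Qed.

(** Each slope m excludes at most q intercepts, a trace fibre, which leaves q^2 (q^2 - q) sloped
    secants; the q^2 vertical lines are added. *)
Lemma card_secants : (q ^ 2 * (q ^ 2 - q + 1) <= #|[set l | secant l]|)%N.
Proof.
pose A := [set mb : F * F | secant (inl mb)].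
have cA : (q ^ 2 * (q ^ 2 - q) <= #|A|)%N.
  rewrite -[X in (_ <= X)%N]sum1_card (partition_big fst predT) //=.
  apply: (@leq_trans (\sum_(m : F) (q ^ 2 - q))%N); first by rewrite sum_nat_const cardF.
  apply: leq_sum => m _; rewrite sum1dep_card.
  apply: leq_trans (leq_sub2l _ (card_trace_fiber_le (- (m * s m)))) _.
  rewrite -cardF -[X in (#|_| - #|pred_of_set X|)%N]setCK -cardsCs.
  rewrite -(card_imset _ (can_inj (fun y : F => erefl : snd (m, y) = y))).
  apply/subset_leq_card/subsetP => u /imsetP[b]; rewrite !inE => hb ->.
  by rewrite eqxx andbT /= addr_eq0.
rewrite mulnDr muln1; apply: leq_trans (leq_add cA (leqnn _)) _.
rewrite -[in X in (_ + X)%N]cardF -cardsT.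
rewrite -(card_imset A (@inl_inj _ F)) -(card_imset [set: F] (@inr_inj (F * F)%type _)).
rewrite -cardsUI (_ : _ :&: _ = set0) ?cards0 ?addn0; last first.
  by apply/setP=> -[mb|c]; rewrite !inE; apply/negP => /andP[/imsetP[? _ ?] /imsetP[? _ ?]].
apply/subset_leq_card/subsetP => l; rewrite !inE => /orP[] /imsetP[x hx ->] //.
by rewrite inE in hx.
Qed.

End Unital.

(** * The unital as an incidence structure, and the graph *)

Lemma unital_design q : prime_power q ->
  exists (P : finType) (inc : P -> 'I_(q ^ 2 * (q ^ 2 - q + 1)) -> bool),
    [/\ (#|P| <= q ^ 3)%N, forall l, (q <= #|[set u | inc u l]|)%N,
        partial_linear inc & onan_free inc].
Proof.
case=> p [k [p_pr [k_gt0 ->]]] {q}; set q := (p ^ k)%N; set n := (_ * _)%N.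
have k2_gt0 : (0 < k * 2)%N by rewrite muln_gt0 k_gt0.
have [F pF cardF] := pPrimePowerField p_pr k2_gt0; rewrite expnM -/q in cardF.
pose s := frob_iter k pF.
pose S := [set l | secant k pF l].
have cS : (n <= #|S|)%N := card_secants pF k_gt0 cardF.
(* Only a lower bound on the number of secants is at hand, so the first n in the enumeration become
   the vertices. *)
pose g (i : 'I_n) := enum_val (widen_ord cS i).
have g_inj : injective g by move=> i j /enum_val_inj /(congr1 val) /= /ord_inj.
have g_sec i : secant k pF (g i) by have := enum_valP (widen_ord cS i); rewrite inE.
pose P : finType := {u : F * F | on_unital s u}.
exists P, (fun u i => on_line (val u) (g i)); split.
- by rewrite card_sig -(cardsE (on_unital s)) (card_unital_points pF k_gt0 cardF).
- move=> i; apply: leq_trans (secant_card k_gt0 cardF (g_sec i)) _.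
  rewrite -(card_imset _ val_inj); apply/subset_leq_card/subsetP => u.
  rewrite inE => /andP[uU ul]; apply/imsetP; exists (Sub u uU : P); last by rewrite SubK.
  by rewrite inE SubK.
- move=> u v i j ui uj vi vj; apply: contraNeq => uv; apply/eqP/g_inj.
  exact: (on_line_unique ui vi uj vj uv).
- move=> l1 l2 l3 l4 p12 p13 p14 p23 p24 p34 a1 a2 a3 a4 l12.
  rewrite -(map_inj_uniq val_inj).
  apply: (@unital_onan_free F (frob_iter k pF) (g l1) (g l2) (g l3) (g l4)) => //.
    by rewrite /= !(valP _).
  by rewrite (inj_eq g_inj).
Qed.

Theorem mainTheorem9 (q : nat) :
  prime_power q -> (2 ^ 40 <= q)%N ->
  exists e : rel 'I_(q ^ 2 * (q ^ 2 - q + 1)),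
    [/\ simple_graph e, K4_free e &
      forall X : {set 'I_(q ^ 2 * (q ^ 2 - q + 1))},
        (2 ^ 24 * q ^ 2 <= #|X|)%N ->
        ((#|X| ^ 2)%:R / (256 * q)%:R : rat) <= (e_induced e X)%:R].
Proof.
move=> q_pp q_large; have [P [inc [cardP card_line inc_unique onan]]] := unital_design q_pp.
have pow_le a b : (a <= b)%N -> (2 ^ a <= 2 ^ b)%N by move=> ab; rewrite leq_exp2l.
have {}q_large : (2 ^ 14 <= q)%N := leq_trans (pow_le 14 40 isT) q_large.
have q_gt1 : (1 < q)%N := leq_trans (pow_le 1 14 isT) q_large.
(* For q >= 2, q^2 (q^2 - q + 1) + 2 <= q^4 - q^2 + 2 <= q^4. *)
have cardL : (#|'I_(q ^ 2 * (q ^ 2 - q + 1))|.+2 <= q ^ 4)%N.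
  rewrite card_ord (expnD q 2 2) -addn2.
  apply: (@leq_trans (q ^ 2 * (q ^ 2 - 1) + 2)%N).
    by rewrite leq_add2r leq_mul2l; apply/orP; right; nia.
  by nia.
have [w hw] := exists_balanced_coloring cardP card_line q_large cardL.
exists (bipartite_pencils inc w); split.
- exact: bipartite_pencils_simple.
- exact: bipartite_pencils_K4_free.
move=> X X_large.
have {}X_large : (2 ^ 7 * q ^ 2 <= #|X|)%N.
  by apply: leq_trans X_large; rewrite leq_mul2r (pow_le 7 24 isT) orbT.
have q_gt0 := ltnW q_gt1.
have hX := e_induced_balanced cardP card_line inc_unique q_gt0 (hw X X_large).
rewrite ler_pdivrMr ?ltr0n ?muln_gt0 // -natrM ler_nat [leqRHS]mulnC.
apply: leq_trans hX _; rewrite leq_mul2r; apply/orP; right.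
by rewrite leq_mul2r orbT.
Qed.
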